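(* The spectral radius of the ancestral matrix of the binary caterpillar $C_n$ satisfies $$\rho_C(C_n)=\frac{4n^2}{\pi^2}-\frac{4n}{\pi^2}+O(1)\qquad (n\to\infty).$$
   Context: A rooted tree $T$ has a distinguished vertex $r$, the root; the level $\ell(v)$ of a vertex $v$ is its distance from $r$. A leaf is a vertex without children (the root counts as a leaf only if it is the only vertex). For vertices $v,w$, $v\vee w$ denotes the common ancestor of $v$ and $w$ farthest from the root (every vertex is an ancestor of itself). If $v_1,\ldots,v_n$ are the leaves, the ancestral matrix $C(T)$ is the $n\times n$ matrix with $(i,j)$ entry $\ell(v_i\vee v_j)$, and $\rho_C(T)$ is its largest eigenvalue. The binary caterpillar $C_n$ is the rooted tree with $n-1$ internal (non-leaf) vertices which form a path with the root at one end, each internal vertex having exactly two children (so $C_n$ has $n$ leaves). *)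

(* Defs.v *)
From mathcomp Require Import all_boot all_order all_algebra.
From mathcomp Require Import all_classical all_reals all_analysis.
Set Implicit Arguments.
Unset Strict Implicit.
Unset Printing Implicit Defensive.
Import Order.TTheory GRing.Theory Num.Theory.
Import numFieldNormedType.Exports.

Local Open Scope classical_set_scope.
Local Open Scope ring_scope.

(* [simple_path e x y p]: [x :: p] is a path of the graph [e], without repeated
   vertices, from [x] to [y]; its length, in edges, is [size p]. *)
Definition simple_path (V : eqType) (e : rel V) (x y : V) (p : seq V) : bool :=
  [&& path e x p, uniq (x :: p) & last x p == y].

Record rooted_tree := RootedTree {
  vertex :> finType;
  adj : rel vertex;
  tree_root : vertex;
  adj_sym : symmetric adj;
  adj_irr : irreflexive adj;
  unique_path : forall x y : vertex, exists! p, simple_path adj x y p }.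

Definition walk_of_length (T : rooted_tree) (x y : T) (k : nat) : bool :=
  [exists p : k.-tuple T, path (@adj T) x p && (last x p == y)].

Lemma walk_exists (T : rooted_tree) (x y : T) :
  exists k, walk_of_length x y k.
Proof.
have [p [/and3P[ep _ lp] _]] := unique_path x y.
by exists (size p); apply/existsP; exists (in_tuple p); rewrite /= ep lp.
Qed.

Definition distance (T : rooted_tree) (x y : T) : nat :=
  ex_minn (walk_exists x y).

Definition level (T : rooted_tree) (v : T) : nat := distance (tree_root T) v.

Definition ancestor (T : rooted_tree) (u v : T) : bool :=
  `[< exists2 p, simple_path (@adj T) (tree_root T) v p &
                 u \in tree_root T :: p >].

Definition child (T : rooted_tree) (v w : T) : bool :=
  adj v w && ancestor v w.

Definition leaf (T : rooted_tree) : pred T :=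
  fun v => [forall w, ~~ child v w].

(* [tree_root T] is only the seed of the maximum: it is always a common
   ancestor. *)
Definition join (T : rooted_tree) (v w : T) : T :=
  [arg max_(u > tree_root T | ancestor u v && ancestor u w) level u]%N.

Definition ancestral_matrix (R : realType) (T : rooted_tree) :
    'M[R]_#|@leaf T| :=
  \matrix_(i, j) (level (join (enum_val i) (enum_val j)))%:R.

(* The matrix is real symmetric of positive size, so its set of eigenvalues in
   [R] is finite and nonempty and the supremum is a maximum. *)
Definition rhoC (R : realType) (T : rooted_tree) : R :=
  sup [set a : R | eigenvalue (ancestral_matrix R T) a].

(* [tree_root T :: p] lists the n - 1 internal vertices in path order; it is
   nonempty, so in particular 2 <= n. *)
Definition binary_caterpillar (n : nat) (T : rooted_tree) : Prop :=
  exists p : seq T,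
    [/\ (size (tree_root T :: p)).+1 = n,
        path (@adj T) (tree_root T) p,
        uniq (tree_root T :: p),
        forall v : T, (v \in tree_root T :: p) = ~~ leaf v &
        forall v : T, ~~ leaf v -> #|child v| = 2%N].

(* Main.v *)
Require Import Defs.
From mathcomp Require Import all_boot all_order all_algebra.
From mathcomp Require Import all_classical all_reals all_analysis.
From mathcomp Require Import ring lra zify.
Set Implicit Arguments.
Unset Strict Implicit.
Unset Printing Implicit Defensive.
Import Order.TTheory GRing.Theory Num.Theory.
Import numFieldNormedType.Exports.
Local Open Scope classical_set_scope.
Local Open Scope ring_scope.

(* Index each leaf by the level [i] of its parent, [0 <= i <= m] with
   [m = n - 2]: two distinct leaves of indices [i], [j] contribute [min(i, j)],
   a leaf of index [i] contributes [i + 1] on the diagonal, and every index is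
   taken once, except [m], which is taken twice.  So the ancestral matrix is the
   identity plus a min-kernel, the inverse of a discrete Laplacian, and
   [x_i = sin(2 i phi)] is an eigenvector for [1 + 1 / (4 sin^2 phi)] as soon as
   the boundary condition [2 cos((2m+1) phi) = cos((2m-1) phi)] holds.  The root
   [phi] with [pi/2 <= (2m+3) phi] and [(2m+1) phi <= pi/2] makes [x] nonnegative,
   so by a Collatz-Wielandt argument the eigenvalue is the largest one.
   Comparing sines in the boundary condition gives
   [(2n-1) phi = pi/2 + O(phi^3)], whence the eigenvalue is
   [1 / (4 phi^2) + O(1) = (2n-1)^2 / pi^2 + O(1)]. *)

(** * Simple paths, levels and ancestors in a rooted tree *)

Lemma simple_path_inj (T : rooted_tree) (x y : T) (p q : seq T) :
  simple_path (@adj T) x y p -> simple_path (@adj T) x y q -> p = q.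
Proof. by have [r [_ Hr]] := unique_path x y => /Hr <- /Hr <-. Qed.

(** Every walk from the root to [v] shortens to a simple path, which is [p] by uniqueness, so no
    walk is shorter than [p]. *)
Lemma level_simple_path (T : rooted_tree) (v : T) (p : seq T) :
  simple_path (@adj T) (tree_root T) v p -> level v = size p.
Proof.
move=> sp; have /and3P[pp _ /eqP lp] := sp.
rewrite /level /distance.
case: ex_minnP => k /existsP[q /andP[pq /eqP lq]] mink.
apply/eqP; rewrite eqn_leq mink /=; last first.
  by apply/existsP; exists (in_tuple p); rewrite /= pp lp eqxx.
move: lq; case/shortenP: pq => q' pq' uq' sq' lq'.
have -> : p = q'.
  by apply: simple_path_inj sp _; rewrite /simple_path pq' uq' lq' eqxx.
rewrite -(size_tuple q); apply: uniq_leq_size => //.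
by case/andP: uq'.
Qed.

Lemma ancestorE (T : rooted_tree) (u v : T) (p : seq T) :
  simple_path (@adj T) (tree_root T) v p ->
  ancestor u v = (u \in tree_root T :: p).
Proof.
move=> sp; apply/asboolP/idP => [[q sq]|up]; last by exists p.
by rewrite (simple_path_inj sp sq).
Qed.

(** The simple path to [w] runs through its ancestor [v]. By uniqueness the piece before [v] is [p],
    and the piece after it is the single edge to [w]. *)
Lemma simple_path_child (T : rooted_tree) (v w : T) (p : seq T) :
  simple_path (@adj T) (tree_root T) v p -> child v w ->
  simple_path (@adj T) (tree_root T) w (rcons p w).
Proof.
move=> sp /andP[vw].
have [q [sq _]] := unique_path (tree_root T) w.
rewrite (ancestorE _ sq) => vq; have /and3P[pq uq /eqP lq] := sq.
move: vq => /path.splitPl vq; case: vq pq uq lq sq => q1 q2 lq1.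
rewrite cat_path last_cat lq1 -cat_cons cat_uniq.
move=> /andP[pq1 pq2] /and3P[uq1 hq uq2] lq2 sq.
have -> : p = q1.
  by apply: simple_path_inj sp _; rewrite /simple_path pq1 uq1 lq1 eqxx.
suff : q2 = [:: w] by move=> e; move: sq; rewrite e cats1.
apply: (@simple_path_inj T v w).
  rewrite /simple_path pq2 lq2 eqxx /= uq2 !andbT.
  by apply: contra hq => vq2; apply/hasP; exists v => //; rewrite -lq1 mem_last.
rewrite /simple_path /= vw eqxx !andbT inE; apply: contraTneq vw => ->.
by rewrite adj_irr.
Qed.

Lemma child_last (T : rooted_tree) (w : T) (p : seq T) :
  simple_path (@adj T) (tree_root T) w (rcons p w) ->
  child (last (tree_root T) p) w.
Proof.
move=> sp; rewrite /child (ancestorE _ sp).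
move: sp => /and3P[]; rewrite rcons_path => /andP[_ ->] _ _.
by rewrite -rcons_cons mem_rcons inE mem_last orbT.
Qed.

(** * Leaves of the caterpillar and levels of their joins *)

Definition spine (T : rooted_tree) (p : seq T) : Prop :=
  [/\ path (@adj T) (tree_root T) p,
      uniq (tree_root T :: p),
      forall v : T, (v \in tree_root T :: p) = ~~ leaf v &
      forall v : T, ~~ leaf v -> #|child v| = 2%N].

Lemma last_take (X : Type) (x : X) (p : seq X) (i : nat) :
  (i <= size p)%N -> last x (take i p) = nth x (x :: p) i.
Proof.
move=> ip; rewrite (last_nth x) size_takel //.
by rewrite -[x :: take i p]/(take i.+1 (x :: p)) nth_take.
Qed.

Lemma spine_simple_path (T : rooted_tree) (p : seq T) (i : nat) :
  spine p -> (i <= size p)%N ->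
  simple_path (@adj T) (tree_root T) (nth (tree_root T) (tree_root T :: p) i)
    (take i p).
Proof.
move=> [pp up _ _] ip; rewrite /simple_path take_path // last_take // eqxx andbT andTb.
by apply: (subseq_uniq _ up); rewrite /= eqxx take_subseq.
Qed.

Lemma level_spine (T : rooted_tree) (p : seq T) (i : nat) :
  spine p -> (i <= size p)%N ->
  level (nth (tree_root T) (tree_root T :: p) i) = i.
Proof.
by move=> sp ip; rewrite (level_simple_path (spine_simple_path sp ip)) size_takel.
Qed.

(** The last vertex before [l] on its root path has the child [l], so it is internal and lies on the
    spine; by uniqueness the path up to it is a prefix of the spine. Thus [(level l).-1] is the
    spine index of the parent. *)
Lemma leaf_simple_path (T : rooted_tree) (p : seq T) (l : T) :
  spine p -> leaf l ->
  ((level l).-1 <= size p)%N /\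
  simple_path (@adj T) (tree_root T) l (rcons (take (level l).-1 p) l).
Proof.
move=> sp ll; have [pp up ps _] := sp.
have [q [sq _]] := unique_path (tree_root T) l.
have lE := level_simple_path sq.
have /and3P[pq uq /eqP lq] := sq.
case/lastP: q => [|q z] in sq lE pq uq lq *.
  by move: (ps l); rewrite ll -lq mem_head.
rewrite last_rcons in lq; subst z; rewrite size_rcons in lE.
rewrite lE /=; have cl := child_last sq.
have nl : ~~ leaf (last (tree_root T) q).
  by apply/negP => /forallP/(_ l); rewrite cl.
rewrite -ps in nl.
have si := nth_index (tree_root T) nl; set i := index _ _ in si.
have ip : (i <= size p)%N.
  by rewrite -ltnS -[(size p).+1]/(size (tree_root T :: p)) index_mem.
have qE : q = take i p.
  apply: simple_path_inj (spine_simple_path sp ip); rewrite si.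
  move: pq uq; rewrite rcons_path -rcons_cons rcons_uniq => /andP[pq _] /andP[_ uq].
  by rewrite /simple_path pq uq eqxx.
have sqi : size q = i by rewrite qE size_takel.
by rewrite sqi; split => //; rewrite -qE.
Qed.

Lemma level_leaf (T : rooted_tree) (p : seq T) (l : T) :
  spine p -> leaf l -> level l = (level l).-1.+1.
Proof.
move=> sp ll; have [ip sl] := leaf_simple_path sp ll.
by rewrite {1}(level_simple_path sl) size_rcons size_takel.
Qed.

(** An ancestor of [v] cuts off a prefix of the root path of [v], so no ancestor has a larger level
    than [v] itself. *)
Lemma level_joinxx (T : rooted_tree) (v : T) : level (join v v) = level v.
Proof.
have [q [sq _]] := unique_path (tree_root T) v.
have /and3P[pq uq /eqP lq] := sq.
have vq : v \in tree_root T :: q by rewrite -lq mem_last.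
rewrite /join; case: arg_maxnP => [|u]; first by rewrite !(ancestorE _ sq) mem_head.
rewrite andbb => au /(_ v); rewrite andbb (ancestorE _ sq).
move=> /(_ vq) vu; apply/eqP; rewrite eqn_leq [(_ <= level u)%N]vu andbT (level_simple_path sq).
move: au; rewrite (ancestorE _ sq) => /path.splitPl uq'.
case: uq' pq uq lq sq => q1 q2 lq1; rewrite cat_path -cat_cons cat_uniq.
move=> /andP[pq1 _] /and3P[uq1 _ _] _ _.
rewrite (@level_simple_path _ u q1) ?size_cat ?leq_addr //.
by rewrite /simple_path pq1 uq1 lq1 eqxx.
Qed.

Lemma level_join_leaf (T : rooted_tree) (p : seq T) (l l' : T) :
  spine p -> leaf l -> leaf l' -> l != l' ->
  level (join l l') = minn (level l).-1 (level l').-1.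
Proof.
move=> sp ll ll' nll'; have [pp up ps _] := sp.
have [ip sl] := leaf_simple_path sp ll; have [jp sl'] := leaf_simple_path sp ll'.
set i := (level l).-1 in ip sl *; set j := (level l').-1 in jp sl' *.
set s := tree_root T :: p in up ps *.
(* Neither leaf is an ancestor of the other, so the common ancestors are the common part of two
   spine prefixes. *)
have anc u : ancestor u l && ancestor u l' = (u \in take (minn i j).+1 s).
  rewrite (ancestorE _ sl) (ancestorE _ sl') -!rcons_cons !mem_rcons ![u \in _ :: _ :: _]in_cons.
  rewrite -![tree_root T :: take _ p]/(take _.+1 (tree_root T :: p)) -/s.
  have lf w k : leaf w -> (w \in take k s) = false.
    by move=> lw; apply/negP => /mem_take; rewrite ps lw.
  have [->|ul] := eqVneq u l; first by rewrite (negbTE nll') !lf.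
  have [->|ul'] := eqVneq u l'; first by rewrite !lf.
  rewrite !orFb; case us: (u \in s); last first.
    have nt k : (u \in take k s) = false.
      by apply/negP => /mem_take; rewrite us.
    by rewrite !nt.
  by rewrite !in_take // !ltnS leq_min.
rewrite /join; case: arg_maxnP => [|u]; rewrite anc; first by rewrite mem_head.
move=> us umax.
have mp : (minn i j <= size p)%N by rewrite geq_min ip.
have := umax (nth (tree_root T) s (minn i j)); rewrite anc level_spine //.
rewrite in_take ?mem_nth ?ltnS // index_uniq ?ltnS // => /(_ (leqnn _)) mu.
apply/eqP; rewrite eqn_leq [(_ <= level u)%N]mu andbT.
have us' := mem_take us; move: us; rewrite in_take // ltnS => us.
rewrite -[in level u](nth_index (tree_root T) us') level_spine //.
exact: leq_trans us mp.
Qed.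

(** Of the two children of the spine vertex at index [i], the only one that can be internal is the
    next spine vertex. It is missing exactly at the end of the spine, where both children are
    leaves. *)
Lemma card_leaf_level (T : rooted_tree) (p : seq T) (i : nat) :
  spine p -> (i <= size p)%N ->
  #|[pred l : T | leaf l && ((level l).-1 == i)]| = (1 + (i == size p))%N.
Proof.
move=> sp ip; have [pp up ps pc] := sp.
set s := tree_root T :: p in up ps; set v := nth (tree_root T) s i.
have vs : simple_path (@adj T) (tree_root T) v (take i p).
  exact: spine_simple_path sp ip.
have nv : ~~ leaf v by rewrite -ps mem_nth // ltnS.
have /eqP := pc v nv; rewrite -(cardID (@leaf T)).
have -> : #|[predI child v & @leaf T]| =
    #|[pred l : T | leaf l && ((level l).-1 == i)]|.
  apply: eq_card => l; rewrite !inE /= -[l \in child v]/(child v l).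
  rewrite -[l \in @leaf T]/(leaf l) andbC.
  case ll: (leaf l) => //=; apply/idP/eqP => [cl|il].
    by rewrite (level_simple_path (simple_path_child vs cl)) size_rcons size_takel.
  have [_ sl] := leaf_simple_path sp ll; have := child_last sl.
  by rewrite il last_take.
have -> : #|[predD child v & @leaf T]| = (i != size p).
  have chS w : ~~ leaf w -> child v w = (index w s == i.+1).
    rewrite -ps => ws; have wi := nth_index (tree_root T) ws.
    have wp : (index w s <= size p)%N.
      by rewrite -ltnS -[(size p).+1]/(size s) index_mem.
    apply/idP/eqP => [cw|iw].
      have := level_simple_path (simple_path_child vs cw).
      by rewrite size_rcons size_takel // -{1}wi level_spine.
    have := spine_simple_path sp wp; rewrite -/s wi iw (take_nth (tree_root T)).
      rewrite -[nth _ p i]/(nth (tree_root T) s i.+1) -iw wi => /child_last.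
      by rewrite last_take.
    by rewrite -iw.
  have [ie|nip] := eqVneq i (size p).
    apply: eq_card0 => w; rewrite !inE -[w \in child v]/(child v w).
    rewrite -[w \in @leaf T]/(leaf w).
    case lw: (leaf w) => //=; rewrite chS ?lw //.
    have: (index w s < size s)%N by rewrite index_mem ps lw.
    by rewrite /s /= -ie => h; apply/negP => /eqP e; rewrite e ltnn in h.
  have is1 : (i.+1 < size s)%N by rewrite /= ltnS ltn_neqAle nip.
  transitivity 1%N => //.
  have s1 := mem_nth (tree_root T) is1; have i1 := index_uniq (tree_root T) is1 up.
  move: s1 i1; set v1 := nth _ _ _ => s1 i1.
  apply: (@fintype.eq_card1 _ v1) => w.
  rewrite !inE -[w \in child v]/(child v w) -[w \in @leaf T]/(leaf w).
  case lw: (leaf w) => /=.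
    by apply/esym/negP => /eqP e; have := ps w; rewrite lw e s1.
  rewrite chS ?lw //; apply/eqP/eqP => [iw|->//].
  by rewrite /v1 -iw nth_index // ps lw.
by move/eqP => h; case: eqP h => /= _; rewrite ?addn0 ?addn1; lia.
Qed.

(** * An upper bound for eigenvalues, and eigenvectors of the min-kernel *)

Lemma eigenvalue_le_supersolution (R : realType) (n : nat) (M : 'M[R]_n)
    (y : 'rV[R]_n) (lam a : R) :
  (forall i j, 0 <= M i j) -> (forall i, 0 < y 0 i) ->
  (forall j, (y *m M) 0 j <= lam * y 0 j) -> eigenvalue M a -> a <= lam.
Proof.
move=> M0 y0 yM /eigenvalueP[v vM v0].
have [i0 vi0] : exists i, v 0 i != 0.
  by move/rV0Pn: v0.
(* Collatz-Wielandt: at an index [j] maximizing [|v i| / y i], the vector [|v|] is dominated by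
   [t * y] with equality at [j], so comparing the two sides there bounds [|a|] by [lam]. *)
have [j _ jmax] := @Order.TotalTheory.arg_maxP _ _ _ i0 xpredT
  (fun i => `|v 0 i| / y 0 i) isT.
have vj : 0 < `|v 0 j| / y 0 j.
  by apply: lt_le_trans (jmax i0 isT); rewrite divr_gt0 // normr_gt0.
set t := _ / _ in jmax vj.
have vt i : `|v 0 i| <= t * y 0 i by rewrite -ler_pdivrMr //; exact: jmax.
have vtj : `|v 0 j| = t * y 0 j by rewrite /t divfK // gt_eqF.
have : `|a| * `|v 0 j| <= t * (lam * y 0 j).
  have -> : `|a| * `|v 0 j| = `|(v *m M) 0 j| by rewrite vM mxE normrM.
  apply: le_trans (_ : t * (y *m M) 0 j <= _); last by rewrite ler_pM2l.
  rewrite !mxE mulr_sumr; apply: le_trans (ler_norm_sum _ _ _) _.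
  by apply: ler_sum => i _; rewrite normrM (ger0_norm (M0 _ _)) mulrA ler_wpM2r.
rewrite vtj [t * (lam * _)]mulrCA ler_pM2r; last exact: mulr_gt0.
exact: le_trans (ler_norm _).
Qed.

(** Since [minn i j] counts the [k < j] with [k < i], the kernel sum adds up the tail sums over
    [i > k]. Each tail telescopes to [mu * (x k.+1 - x k)], and these increments add up to
    [mu * x j]. *)
Lemma min_kernel_sum (R : realType) (m j : nat) (mu : R) (x w : nat -> R) :
  (j <= m)%N -> x 0%N = 0 ->
  (forall i, (i.+1 < m)%N -> w i.+1 * x i.+1 = mu * (2 * x i.+1 - x i - x i.+2)) ->
  (forall i, i.+1 = m -> w m * x m = mu * (x m - x i)) ->
  \sum_(i < m.+1) w i * x i * (minn i j)%:R = mu * x j.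
Proof.
move=> jm x0 xS xm.
(* Setting [d] to zero at [m] gives the boundary equation the same form as the interior ones. *)
pose d i := if (i < m)%N then mu * (x i.+1 - x i) else 0.
have dE i : (0 < i <= m)%N -> w i * x i = d i.-1 - d i.
  case: i => // i /andP[_]; rewrite leq_eqVlt => /orP[/eqP im|im].
    by rewrite /d /= im ltnn -im leqnn subr0 im (xm i).
  rewrite xS // /d /= im (ltnW im).
  ring.
have tail k : (k < m)%N -> \sum_(i < m.+1 | (k < i)%N) w i * x i = d k.
  move=> km; rewrite -(big_mkord (fun i => (k < i)%N) (fun i => w i * x i)).
  rewrite (@big_cat_nat _ _ _ k.+1) //=; last by rewrite ltnS ltnW.
  rewrite big_nat_cond big_pred0 => [|i]; last by rewrite ltnS; lia.
  rewrite big_nat_cond (eq_bigl (fun i => k < i < m.+1)%N); last by move=> i; lia.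
  rewrite -big_nat (eq_big_nat _ _ (F2 := fun i => - (d i - d i.-1))); last first.
    by move=> i ikm; rewrite dE ?opprB //; lia.
  rewrite sumrN big_add1 /= telescope_sumr; last by lia.
  by rewrite {1}/d ltnn add0r sub0r opprK.
elim: j jm => [|j IHj] jm.
  by rewrite x0 mulr0 big1 // => i _; rewrite minn0 mulr0.
transitivity (\sum_(i < m.+1) w i * x i * (minn i j)%:R
              + \sum_(i < m.+1 | (j < i)%N) w i * x i).
  rewrite [X in _ + X]big_mkcond -big_split /=; apply: eq_bigr => i _.
  case: ifP => ij.
    have -> : minn i j.+1 = (minn i j).+1 by lia.
    by rewrite -natr1; ring.
  have -> : minn i j.+1 = minn i j by lia.
  by rewrite addr0.
by rewrite IHj 1?ltnW // tail // /d jm; ring.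
Qed.

(** * Trigonometric bounds and the root of the boundary condition *)

Lemma sin_le_id (R : realType) (x : R) : 0 <= x -> sin x <= x.
Proof.
move=> x0.
have [c _] := @MVT_segment R sin cos 0 x x0 (fun y _ => is_derive_sin y)
  (continuous_subspaceT (@continuous_sin R)).
rewrite sin0 !subr0 => ->.
by rewrite ler_piMl // cos_le1.
Qed.

Lemma cos_ge_quadratic (R : realType) (x : R) : 0 <= x -> 1 - x ^+ 2 / 2 <= cos x.
Proof.
(* Beyond 2 the left side is below -1; up to 2 the half-angle formula reduces the claim to
   [sin (x / 2) <= x / 2]. *)
move=> x0; have [xpi|pix] := leP x 2; last first.
  by have := cos_geN1 x; nra.
have -> : cos x = 1 - 2 * sin (x / 2) ^+ 2.
  have -> : cos x = cos (x / 2 *+ 2) by congr cos; rewrite mulr2n -splitr.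
  by rewrite cos_mulr2n cos2sin2; ring.
have := @sin_le_id R (x / 2) ltac:(lra).
have := @sin_ge0_pi R (x / 2) ltac:(have := pi_ge2 R; lra).
nra.
Qed.

Lemma sin_ge_cubic (R : realType) (x : R) : 0 <= x -> x - x ^+ 3 / 2 <= sin x.
Proof.
move=> x0.
have [c] := @MVT_segment R sin cos 0 x x0 (fun y _ => is_derive_sin y)
  (continuous_subspaceT (@continuous_sin R)).
rewrite in_itv /= sin0 !subr0 => /andP[c0 cx] ->.
have := cos_ge_quadratic c0; have : c ^+ 2 <= x ^+ 2 by rewrite ler_sqr.
move=> h1 h2; have : 1 - x ^+ 2 / 2 <= cos c by lra.
move/(ler_wpM2r x0); apply: le_trans.
by rewrite le_eqVlt; apply/orP; left; apply/eqP; field.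
Qed.

Lemma cos_root_exists (R : realType) (m : nat) :
  exists phi : R, [/\ pi / 2 <= (m%:R *+ 2 + 3) * phi,
    (m%:R *+ 2 + 1) * phi <= pi / 2 &
    2 * cos ((m%:R *+ 2 + 1) * phi) = cos ((m%:R *+ 2 - 1) * phi)].
Proof.
have pi2 := pi_ge2 R.
pose k : R := m%:R *+ 2; have k0 : 0 <= k by rewrite /k mulrn_wge0.
pose g (y : R) := 2 * cos ((k + 1) * y) - cos ((k - 1) * y).
pose a := pi / 2 / (k + 3) : R; pose b := pi / 2 / (k + 1) : R.
have k3 : 0 < k + 3 by lra.
have k1 : 0 < k + 1 by lra.
have aE : (k + 3) * a = pi / 2 by rewrite /a mulrC divfK // gt_eqF.
have bE : (k + 1) * b = pi / 2 by rewrite /b mulrC divfK // gt_eqF.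
have a0 : 0 < a by rewrite /a divr_gt0 //; lra.
have b0 : 0 < b by rewrite /b divr_gt0 //; lra.
have ab : a <= b by nra.
(* By the choice of [a] the two cosines become [sin (2 a)] and [sin (4 a)], so
   [g a = 2 sin (2 a) (1 - cos (2 a))]. *)
have ga : 0 <= g a.
  rewrite /g.
  have -> : (k + 1) * a = pi / 2 - a *+ 2 by rewrite -aE mulr2n; ring.
  have -> : (k - 1) * a = pi / 2 - a *+ 2 *+ 2 by rewrite -aE !mulr2n; ring.
  rewrite ![cos (pi / 2 - _)]cosB cos_pihalf sin_pihalf !mul0r !add0r !mul1r.
  rewrite [sin (a *+ 2 *+ 2)]sin_mulr2n.
  have s0 : 0 <= sin (a *+ 2) by apply: sin_ge0_pi; rewrite mulr2n; nra.
  by have := cos_le1 (a *+ 2); rewrite -[_ *+ 2 in X in 0 <= X]mulr_natl; nra.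
have gb : g b <= 0.
  rewrite /g bE cos_pihalf mulr0 sub0r oppr_le0.
  by apply: cos_ge0_pihalf; nra.
have [phi] : exists2 c, c \in `[a, b] & g c = 0.
  apply: IVT => //; last by rewrite ge_min le_max ga gb orbT.
  apply: continuous_subspaceT => y.
  have cos_comp (c : R) : {for y, continuous (fun z => cos (c * z))}.
    apply: (@continuous_comp _ _ _ ( *%R c) cos).
      exact: mulrl_continuous.
    exact: continuous_cos.
  apply: cvgB; last exact: cos_comp.
  by apply: cvgM; [exact: cvg_cst|exact: cos_comp].
rewrite in_itv /= => /andP[ap pb] gphi; exists phi; split.
- by rewrite -aE ler_pM2l.
- by rewrite -bE ler_pM2l.
- by apply/eqP; rewrite -subr_eq0 -/(g phi) gphi.
Qed.

(** With [u = pi / 2 - (k + 1) phi] the condition reads [2 sin u = sin (u + 2 phi)]. Bounding the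
    left by [2 u] and the right below by the cubic estimate gives [u >= 2 phi - 32 phi ^+ 3], where
    32 is half of 4 cubed because [u + 2 phi <= 4 phi]. *)
Lemma cos_root_le (R : realType) (k phi : R) : 0 <= k -> 0 <= phi ->
  pi / 2 <= (k + 3) * phi -> (k + 1) * phi <= pi / 2 ->
  2 * cos ((k + 1) * phi) = cos ((k - 1) * phi) ->
  (k + 3) * phi <= pi / 2 + 32 * phi ^+ 3.
Proof.
move=> k0 p0 ap pb gp.
pose u := pi / 2 - (k + 1) * phi.
have u0 : 0 <= u by rewrite /u; lra.
have u2 : u <= 2 * phi by rewrite /u; lra.
have : 2 * sin u = sin (u + 2 * phi).
  rewrite /u.
  have -> : pi / 2 - (k + 1) * phi + 2 * phi = pi / 2 - (k - 1) * phi by ring.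
  by rewrite ![sin (pi / 2 - _)]sinB cos_pihalf sin_pihalf !mul0r !subr0 !mul1r.
have := @sin_le_id R u u0.
have w0 : 0 <= u + 2 * phi by lra.
have := @sin_ge_cubic R _ w0.
have : (u + 2 * phi) ^+ 3 <= (4 * phi) ^+ 3.
  by apply: lerXn2r; rewrite ?nnegrE; lra.
rewrite exprMn => h1 h2 h3 h4.
have e : (k + 3) * phi = pi / 2 - u + 2 * phi by rewrite /u; ring.
rewrite e; have : (4 : R) ^+ 3 = 64 by rewrite -natrX.
by move=> e4; rewrite e4 in h1; lra.
Qed.

(** * The spectral radius in closed form *)

Lemma sum_leaf (R : realType) (T : rooted_tree) (p : seq T) (F : nat -> R) :
  spine p ->
  \sum_(l : T | leaf l) F (level l).-1 =
  \sum_(i < (size p).+1) (1 + (i == size p :> nat))%:R * F i.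
Proof.
move=> sp; pose a (l : T) : 'I_(size p).+1 := inord (level l).-1.
have aE l : leaf l -> a l = (level l).-1 :> nat.
  by move=> ll; rewrite inordK // ltnS; have [] := leaf_simple_path sp ll.
rewrite (partition_big a xpredT) //=; apply: eq_bigr => i _.
transitivity (\sum_(l in [pred l : T | leaf l && ((level l).-1 == i)]) F i).
  apply: eq_big => [l|l /andP[ll /eqP <-]]; last by rewrite aE.
  rewrite inE; case ll: (leaf l) => //=.
  by rewrite -(inj_eq val_inj) /= aE.
by rewrite sumr_const (card_leaf_level sp) ?mulr_natl // -ltnS.
Qed.

Lemma sum_leaf_join (R : realType) (T : rooted_tree) (p : seq T) (l' : T)
    (F : nat -> R) : spine p -> leaf l' ->
  \sum_(l : T | leaf l) F (level l).-1 * (level (join l l'))%:R =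
  \sum_(i < (size p).+1)
    (1 + (i == size p :> nat))%:R * F i * (minn i (level l').-1)%:R
  + F (level l').-1.
Proof.
move=> sp ll'.
under [X in _ = X + _]eq_bigr do rewrite -mulrA.
rewrite -(sum_leaf (fun i => F i * (minn i (level l').-1)%:R) sp).
(* The diagonal entry is [level l'], one more than the min-kernel gives; this excess is the extra
   term [F (level l').-1]. *)
rewrite (bigD1 l') //= [in RHS](bigD1 l') //= level_joinxx.
rewrite {2}(level_leaf sp ll') -natr1 minnn mulrDr mulr1 -!addrA; congr +%R.
rewrite addrC; congr +%R; apply: eq_bigr => l /andP[ll nll'].
by rewrite (level_join_leaf sp).
Qed.

(* [x] vanishes on the leaf attached to the root, which forms a block of its
   own in the matrix; adding the indicator of that leaf to the eigenvector makes
   it positive. *)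
Lemma rhoC_spine (R : realType) (T : rooted_tree) (p : seq T) (mu : R)
    (x : nat -> R) :
  spine p -> (0 < size p)%N -> 0 <= mu -> x 0%N = 0 ->
  (forall i, (0 < i <= size p)%N -> 0 < x i) ->
  (forall j, (j <= size p)%N ->
    \sum_(i < (size p).+1) (1 + (i == size p :> nat))%:R * x i * (minn i j)%:R
    = mu * x j) ->
  rhoC R T = 1 + mu.
Proof.
move=> sp p0 mu0 x0 xpos xmu.
have lp (l : T) : leaf l -> ((level l).-1 <= size p)%N.
  by move=> ll; have [] := leaf_simple_path sp ll.
pose lev (i : 'I_#|@leaf T|) := (level (enum_val i)).-1.
have lf (i : 'I_#|@leaf T|) : leaf (enum_val i) := enum_valP i.
have mulE (F : nat -> R) j :
    ((\row_i F (lev i)) *m ancestral_matrix R T) 0 j =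
    \sum_(i < (size p).+1)
      (1 + (i == size p :> nat))%:R * F i * (minn i (lev j))%:R + F (lev j).
  rewrite -(sum_leaf_join F sp (lf j)) mxE.
  transitivity (\sum_(l in @leaf T)
    F (level l).-1 * (level (join l (enum_val j)))%:R); last exact: eq_bigl.
  by rewrite [RHS]big_enum_val; apply: eq_bigr => i _; rewrite !mxE.
have eig : eigenvalue (ancestral_matrix R T) (1 + mu).
  apply/eigenvalueP; exists (\row_i x (lev i)).
    apply/rowP => j; rewrite mulE xmu ?lp ?lf // !mxE; ring.
  have /card_gt0P[l] :
      (0 < #|[pred l : T | leaf l && ((level l).-1 == size p)]|)%N.
    by rewrite (card_leaf_level sp) // eqxx.
  rewrite inE => /andP[ll /eqP lE].
  have lA : l \in @leaf T by [].
  apply/rV0Pn; exists (enum_rank_in lA l); rewrite mxE /lev enum_rankK_in // lE.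
  by rewrite gt_eqF // xpos // p0 leqnn.
have ub : ubound [set a : R | eigenvalue (ancestral_matrix R T) a] (1 + mu).
  move=> a /=; pose y i := x i + (i == 0%N)%:R.
  have y0 i : (i <= size p)%N -> 0 < y i.
    case: i => [|i] ip; first by rewrite /y x0 add0r ltr01.
    by rewrite /y addr0 xpos.
  apply: (@eigenvalue_le_supersolution _ _ _ (\row_i y (lev i))).
  - by move=> i j; rewrite mxE ler0n.
  - by move=> i; rewrite mxE y0 // lp // lf.
  move=> j; rewrite mulE mxE.
  (* The added indicator sits at index 0, where [minn] vanishes, so it does not change the kernel
     sum. *)
  rewrite (eq_bigr (fun i : 'I__ =>
      (1 + (i == size p :> nat))%:R * x i * (minn i (lev j))%:R)).
    have b0 : 0 <= mu * (lev j == 0%N)%:R by rewrite mulr_ge0.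
    by rewrite xmu ?lp ?lf // /y; lra.
  move=> i _; rewrite /y.
  by have [->|_] := eqVneq (i : nat) 0%N; rewrite ?min0n ?mulr0 ?addr0.
apply/eqP; rewrite eq_le; apply/andP; split.
  by apply: ge_sup => //; exists (1 + mu).
by apply: ub_le_sup => //; exists (1 + mu).
Qed.

Lemma rhoC_caterpillar (R : realType) (T : rooted_tree) (p : seq T) (phi : R) :
  spine p -> (0 < size p)%N -> 0 < phi ->
  ((size p)%:R *+ 2 + 1) * phi <= pi / 2 ->
  2 * cos (((size p)%:R *+ 2 + 1) * phi) = cos (((size p)%:R *+ 2 - 1) * phi) ->
  rhoC R T = 1 + (4 * sin phi ^+ 2)^-1.
Proof.
move=> sp p0 phi0 phile root; set m := size p in p0 phile root *.
have pi2 := pi_ge2 R.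
have m1 : 1 <= m%:R :> R by rewrite ler1n.
have s0 : 0 < sin phi.
  by apply: sin_gt0_pi; rewrite phi0 /=; rewrite mulr2n in phile; nra.
have mu0 : 4 * sin phi ^+ 2 != 0 :> R by rewrite gt_eqF // mulr_gt0 ?exprn_gt0.
have c2 : cos phi ^+ 2 = 1 - sin phi ^+ 2 := cos2sin2 phi.
have cd : cos (2 * phi) = 1 - 2 * sin phi ^+ 2.
  by rewrite mulr_natl cos_mulr2n c2; ring.
have sd : sin (2 * phi) = 2 * (cos phi * sin phi).
  by rewrite mulr_natl sin_mulr2n mulr_natl.
pose x (i : nat) : R := sin (i%:R * (2 * phi)).
have xS i : x i.+1 = sin (i%:R * (2 * phi) + 2 * phi).
  by rewrite /x -natr1; congr sin; ring.
have xP i : x i = sin (i.+1%:R * (2 * phi) - 2 * phi).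
  by rewrite /x -natr1; congr sin; ring.
apply: (rhoC_spine (x := x) sp) => //.
- by rewrite invr_ge0 mulr_ge0 // exprn_ge0 // ltW.
- by rewrite /x mul0r sin0.
- move=> i /andP[i0 im]; apply: sin_gt0_pi.
  have : i%:R <= m%:R :> R by rewrite ler_nat.
  have : 1 <= i%:R :> R by rewrite ler1n.
  by rewrite mulr2n in phile; nra.
move=> j jm; apply: min_kernel_sum (fun i => (1 + (i == m))%:R : R) _ _ _ _ => //.
- by rewrite /x mul0r sin0.
(* In the interior the second difference of [x] is [2 (1 - cos (2 phi)) = 4 sin^2 phi] times [x]. *)
- move=> i im; rewrite (ltn_eqF im) addn0 mul1r.
  apply: (mulfI mu0); rewrite mulVKf //.
  rewrite (xS i.+1) (xP i) sinB sinD cd -/(x i.+1); ring.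
move=> i im; rewrite eqxx.
apply: (mulfI mu0); rewrite mulVKf //.
rewrite (xP i) im sinB cd sd -/(x m).
move: root.
have -> : (m%:R *+ 2 + 1) * phi = m%:R * (2 * phi) + phi by rewrite mulr2n; ring.
have -> : (m%:R *+ 2 - 1) * phi = m%:R * (2 * phi) - phi by rewrite mulr2n; ring.
rewrite cosD cosB -/(x m); set A := cos (m%:R * _) => root.
have -> : A * (2 * (cos phi * sin phi)) = 2 * sin phi * (A * cos phi) by ring.
(* The expanded boundary condition is [2 (A cos phi - x m sin phi) = A cos phi + x m sin phi]. *)
have -> : A * cos phi = 3 * (x m * sin phi) by lra.
by rewrite -[(1 + true)%N]/2%N; ring.
Qed.

(** * Asymptotic expansion *)

Lemma inv_sin_sqr_bounds (R : realType) (x : R) : 0 < x -> x <= 2 / 3 ->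
  (x ^+ 2)^-1 <= (sin x ^+ 2)^-1 <= (x ^+ 2)^-1 + 2.
Proof.
move=> x0 x1.
have h := sin_ge_cubic (ltW x0); have h' := sin_le_id (ltW x0).
have hs : 0 < x - x ^+ 3 / 2 by rewrite exprS expr2; nra.
have s0 : 0 < sin x by lra.
have sx : sin x ^+ 2 <= x ^+ 2 by rewrite ler_sqr ?nnegrE; lra.
have sx' : (x - x ^+ 3 / 2) ^+ 2 <= sin x ^+ 2 by rewrite ler_sqr ?nnegrE; lra.
have s2 : 0 < sin x ^+ 2 by rewrite exprn_gt0.
have x2 : 0 < x ^+ 2 by rewrite exprn_gt0.
rewrite lef_pV2 ?posrE // sx /=.
rewrite -[X in _ <= X](@mulfK _ (sin x ^+ 2)) ?gt_eqF // -[X in X <= _]mul1r.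
rewrite ler_pM2r ?invr_gt0 //.
have e : (x ^+ 2)^-1 + 2 = (1 + 2 * x ^+ 2) / x ^+ 2.
  by field; rewrite gt_eqF.
rewrite e mulrAC ler_pdivlMr // mul1r.
apply: le_trans (ler_wpM2l _ sx'); last by nra.
have -> : (x - x ^+ 3 / 2) ^+ 2 = x ^+ 2 * (1 - x ^+ 2 / 2) ^+ 2 by field.
rewrite mulrCA ler_peMr ?ltW //.
(* With [t = x ^+ 2], what is left is [1 <= (1 + 2 t) (1 - t / 2)^2] for [0 < t <= 4 / 9]. *)
have : x ^+ 2 <= 4 / 9 by rewrite expr2; nra.
by move: (x ^+ 2) x2 => t *; nra.
Qed.

Lemma caterpillar_asymptotics (R : realType) (m : nat) (phi : R) :
  (0 < m)%N -> 0 < phi -> pi / 2 <= (m%:R *+ 2 + 3) * phi ->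
  (m%:R *+ 2 + 1) * phi <= pi / 2 ->
  2 * cos ((m%:R *+ 2 + 1) * phi) = cos ((m%:R *+ 2 - 1) * phi) ->
  `|1 + (4 * sin phi ^+ 2)^-1
    - (4 * m.+2%:R ^+ 2 / pi ^+ 2 - 4 * m.+2%:R / pi ^+ 2)| <= 300.
Proof.
move=> m0 phi0 ap pb root.
have pi2 := pi_ge2 R; have pi4 := pihalf_lt2 R.
have m1 : 1 <= m%:R :> R by rewrite ler1n.
have phi1 : phi <= 2 / 3 by rewrite mulr2n in pb; nra.
have /andP[lo hi] := inv_sin_sqr_bounds phi0 phi1.
have k0 : 0 <= m%:R *+ 2 :> R by rewrite mulrn_wge0.
have := cos_root_le k0 (ltW phi0) ap pb root.
set N := m%:R *+ 2 + 3 in ap * => hN.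
have pi0 : (pi : R) != 0 by rewrite gt_eqF // pi_gt0.
have pip : 0 < pi ^+ 2 :> R by rewrite exprn_gt0 // pi_gt0.
have p2 : 0 < phi ^+ 2 :> R by rewrite exprn_gt0.
(* For [n = m + 2] one has [N = 2 n - 1], hence [4 n^2 - 4 n = N^2 - 1]. *)
have -> : 4 * m.+2%:R ^+ 2 / pi ^+ 2 - 4 * m.+2%:R / pi ^+ 2
    = N ^+ 2 / pi ^+ 2 - (pi ^+ 2)^-1 :> R.
  rewrite /N -!natr1 mulr2n; move: (pi : R) pi0 => q q0.
  by field.
have -> : (4 * sin phi ^+ 2)^-1 = (sin phi ^+ 2)^-1 / 4 by rewrite invfM mulrC.
have pi_inv : 0 <= ((pi : R) ^+ 2)^-1 <= 1.
  apply/andP; split; first by rewrite invr_ge0 ltW.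
  by rewrite invf_le1 // expr2; nra.
have NE : N ^+ 2 / pi ^+ 2 = (N * phi) ^+ 2 / pi ^+ 2 / phi ^+ 2.
  by move: (pi : R) pi0 => q q0; field; rewrite q0 gt_eqF.
have Nlo : (phi ^+ 2)^-1 / 4 <= N ^+ 2 / pi ^+ 2.
  rewrite NE mulrC ler_pM2r ?invr_gt0 // ler_pdivlMr //.
  have := @lerXn2r R 2 (pi / 2) (N * phi); rewrite !nnegrE.
  by move=> /(_ ltac:(lra) ltac:(lra) ap); rewrite expr_div_n; lra.
(* Squaring [pi / 2 + 32 phi^3] leaves a cross term and a square, bounded in [h1] and [h2] by 16 and
   256 times [pi^2 phi^2]; together they give 272. *)
have Nhi : N ^+ 2 / pi ^+ 2 <= (phi ^+ 2)^-1 / 4 + 272.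
  have -> : (phi ^+ 2)^-1 / 4 + 272 = (1 / 4 + 272 * phi ^+ 2) / phi ^+ 2.
    by field; rewrite gt_eqF.
  rewrite NE ler_pM2r ?invr_gt0 // ler_pdivrMr //.
  have := @lerXn2r R 2 (N * phi) (pi / 2 + 32 * phi ^+ 3); rewrite !nnegrE.
  have p3 : 0 <= phi ^+ 3 by rewrite exprn_ge0 // ltW.
  move=> /(_ ltac:(lra) ltac:(lra) hN) /le_trans; apply.
  have p32 : phi ^+ 3 <= phi ^+ 2 by rewrite exprS; nra.
  have p31 : phi ^+ 3 <= 1 by rewrite exprn_ile1 ?ltW //; lra.
  move: (phi ^+ 3) (phi ^+ 2) p2 p3 p32 p31 => c t t0 c0 ct c1.
  move: (pi : R) pi2 pi4 => q q2 q4.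
  have h1 : 32 * (q * c) <= 16 * (q ^+ 2 * t).
    have : q * c <= q * t by rewrite ler_wpM2l //; lra.
    have : 0 <= q * (q - 2) * t by rewrite !mulr_ge0 //; lra.
    by lra.
  have h2 : 1024 * c ^+ 2 <= 256 * (q ^+ 2 * t).
    have : c ^+ 2 <= c by rewrite expr2 ler_piMl.
    have : 0 <= (q - 2) * (q + 2) * t by rewrite !mulr_ge0 //; lra.
    by lra.
  lra.
(* The bounds collected put the difference between -271 and 5/2. *)
by rewrite ler_norml; apply/andP; split; lra.
Qed.

Theorem theorem2p13 (R : realType) (C : nat -> rooted_tree)
    (hC : forall n : nat, (2 <= n)%N -> binary_caterpillar n (C n)) :
  (fun n : nat => rhoC R (C n)) =
    (fun n : nat => 4 * n%:R ^+ 2 / pi ^+ 2 - 4 * n%:R / pi ^+ 2)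
      +O_\oo (fun _ : nat => 1 : R).
Proof.
apply/eqaddOP; near=> K; near=> n.
(* From [n = 3] on the spine has a second vertex, so [size p = n - 2] is positive and the sine
   vector is nonzero. *)
have n3 : (3 <= n)%N by near: n; exact: nbhs_infty_ge.
have [p [sn pp up ps pc]] := hC n (ltnW n3).
have sp : spine p by [].
have p0 : (0 < size p)%N by rewrite -sn in n3.
have [phi [ap pb root]] := cos_root_exists R (size p).
have phi0 : 0 < phi.
  have := pi_ge2 R; have : 0 <= (size p)%:R *+ 2 :> R by rewrite mulrn_wge0.
  by nra.
rewrite !fctE (rhoC_caterpillar sp p0 phi0 pb root).
have -> : n%:R = (size p).+2%:R :> R by congr _%:R; exact: esym sn.
rewrite normr1 mulr1; apply: le_trans (caterpillar_asymptotics p0 phi0 ap pb root) _.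
by near: K; exact: nbhs_pinfty_ge.
Unshelve. all: by end_near. Qed.
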